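(* Let $f:\operatorname{dom} f\subseteq\mathbb{R}^n\to\mathbb{R}$ be $\mathcal{C}^3$ on $B(x^0;\overline{\Delta})$, where $x^0\in\operatorname{dom} f$ is the point of interest and $\overline{\Delta}>0$. Denote by $L_{\nabla^2 f}$ the Lipschitz constant of $\nabla^2 f$ on $B(x^0;\overline{\Delta})$. Let $S=[s^1\;\cdots\;s^m]\in\mathbb{R}^{n\times m}$ and $T=[t^1\;\cdots\;t^k]\in\mathbb{R}^{n\times k}$ have full row rank, and assume that $B(x^0+s^i;\Delta_T)\subset B(x^0;\overline{\Delta})$ for all $i\in\{1,\dots,m\}$. Then $$\|\nabla_s^2 f(x^0;S,T)-\nabla^2 f(x^0)\|\le\frac{m\sqrt{k}}{3}L_{\nabla^2 f}\left(2\frac{\Delta_u}{\Delta_l}+3\right)\left\|(\widehat{S}^\top)^\dagger\right\|\left\|\widehat{T}^\dagger\right\|\Delta_u,$$ where $\widehat{S}=S/\Delta_S$, $\widehat{T}=T/\Delta_T$, $\Delta_u=\max\{\Delta_S,\Delta_T\}$ and $\Delta_l=\min\{\Delta_S,\Delta_T\}$. Moreover, if $\Delta_u=\Delta_l$, then $$\|\nabla_s^2 f(x^0;S,T)-\nabla^2 f(x^0)\|\le\frac{5m\sqrt{k}}{3}L_{\nabla^2 f}\left\|(\widehat{S}^\top)^\dagger\right\|\left\|\widehat{T}^\dagger\right\|\Delta_u.$$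
   Context: $B(x;r)$ is the open Euclidean ball of radius $r$ centred at $x$. Vector norms are Euclidean and matrix norms are the induced 2-norm (spectral norm). $A^\dagger$ is the Moore--Penrose pseudoinverse of $A$. $\Delta_S=\max_{1\le i\le m}\|s^i\|$ and $\Delta_T=\max_{1\le j\le k}\|t^j\|$. The generalized simplex gradient of $f$ at $x$ over $T$ (where $x$ and all $x+t^j$ lie in $\operatorname{dom} f$) is $\nabla_s f(x;T)=(T^\top)^\dagger\delta_f(x;T)$, where $\delta_f(x;T)=\big(f(x+t^1)-f(x),\dots,f(x+t^k)-f(x)\big)^\top\in\mathbb{R}^k$. The nested-set Hessian of $f$ at $x^0$ over $S$ and $T$ (where $x^0$, $x^0+s^i$, $x^0+t^j$ and $x^0+s^i+t^j$ lie in $\operatorname{dom} f$ for all $i\in\{1,\dots,m\}$ and $j\in\{1,\dots,k\}$) is $\nabla_s^2 f(x^0;S,T)=(S^\top)^\dagger\delta_{\nabla_s f}(x^0;S,T)\in\mathbb{R}^{n\times n}$, where $\delta_{\nabla_s f}(x^0;S,T)\in\mathbb{R}^{m\times n}$ is the matrix whose $i$-th row is $(\nabla_s f(x^0+s^i;T)-\nabla_s f(x^0;T))^\top$.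
   Formalization: All sample points, in particular every x^0+s^i+t^j, are assumed to lie in the open ball B(x^0;Δ̄); the inclusion of open balls allows a boundary point, where f is arbitrary and the bound can fail. *)

(* Defs.v *)
From HB Require Import structures.
From mathcomp Require Import all_boot all_order all_algebra.
From mathcomp Require Import boolp classical_sets reals topology normedtype.
From mathcomp Require Import derive.

Set Implicit Arguments.
Unset Strict Implicit.
Unset Printing Implicit Defensive.

Import Order.TTheory GRing.Theory Num.Theory.
Import numFieldNormedType.Exports.

Local Open Scope classical_set_scope.
Local Open Scope ring_scope.

(* The library norm `|v| on matrices is the sup norm; it induces the same
   topology (hence the same derivatives) as the Euclidean norm below. *)
Definition enorm (R : realType) n (v : 'cV[R]_n) : R :=
  Num.sqrt (\sum_(i < n) v i 0 ^+ 2).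

Definition eball (R : realType) n (x : 'cV[R]_n) (r : R) : set 'cV[R]_n :=
  [set y | enorm (y - x) < r].

(* Norm induced by the Euclidean norms. *)
Definition spnorm (R : realType) m n (A : 'M[R]_(m, n)) : R :=
  sup [set enorm (A *m v) | v in [set v : 'cV[R]_n | enorm v <= 1]].

Definition penrose (R : realType) m n (A : 'M[R]_(m, n)) (X : 'M[R]_(n, m)) :=
  [/\ A *m X *m A = A,
      X *m A *m X = X,
      (A *m X)^T = A *m X &
      (X *m A)^T = X *m A].

(* Moore-Penrose inverse; the default 0 is never used, see [pinvP]. *)
Definition pinv (R : realType) m n (A : 'M[R]_(m, n)) : 'M[R]_(n, m) :=
  xget 0 [set X | penrose A X].

Lemma penrose_uniq (R : realType) m n (A : 'M[R]_(m, n)) (X Y : 'M[R]_(n, m)) :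
  penrose A X -> penrose A Y -> X = Y.
Proof.
move=> [X1 X2 X3 X4] [Y1 Y2 Y3 Y4].
have eA : A *m X = A *m Y.
  rewrite -[LHS]X3 -{1}Y1 -mulmxA trmx_mul X3 Y3.
  by rewrite mulmxA X1.
have eB : X *m A = Y *m A.
  rewrite -[LHS]X4 -{1}Y1 -!mulmxA mulmxA trmx_mul Y4 X4.
  by rewrite -!mulmxA (mulmxA A X A) X1.
by rewrite -X2 -mulmxA eA mulmxA eB Y2.
Qed.

Lemma gram_unit (R : realType) m n (F : 'M[R]_(m, n)) :
  row_free F -> F *m F^T \in unitmx.
Proof.
move=> Ff; rewrite -row_free_unit -kermx_eq0; apply/eqP/row_matrixP => i.
rewrite row0; set v := row i _.
have vFF : v *m (F *m F^T) = 0 by rewrite -row_mul mulmx_ker row0.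
have : (v *m F *m (v *m F)^T) 0 0 = 0.
  by rewrite trmx_mul mulmxA -(mulmxA v) vFF mul0mx mxE.
rewrite mxE => /eqP.
rewrite psumr_eq0; last by move=> j _; rewrite [_^T _ _]mxE -expr2 sqr_ge0.
move=> /allP h; suff vF0 : v *m F = 0.
  by apply: (row_free_inj Ff); rewrite vF0 mul0mx.
apply/rowP => j; rewrite [RHS]mxE; have := h j (mem_index_enum j).
by rewrite /= [_^T _ _]mxE -expr2 sqrf_eq0 => /eqP.
Qed.

Lemma pinvP (R : realType) m n (A : 'M[R]_(m, n)) : penrose A (pinv A).
Proof.
suff [X hX] : exists X, penrose A X by exact: (@xgetI _ _ _ X).
have : exists r (C : 'M[R]_(m, r)) (F : 'M[R]_(r, n)),
    [/\ row_full C, row_free F & A = C *m F].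
  exists (\rank A), (col_base A), (row_base A).
  by rewrite col_base_full row_base_free mulmx_base.
move=> [r [C [F [fC fF eA]]]].
have uF : F *m F^T \in unitmx by exact: gram_unit.
have uC : C^T *m C \in unitmx.
  rewrite -{2}[C]trmxK; apply/gram_unit.
  by rewrite /row_free mxrank_tr; exact: fC.
pose P := invmx (F *m F^T); pose Q := invmx (C^T *m C).
pose X := F^T *m P *m Q *m C^T.
have eAX : A *m X = C *m Q *m C^T.
  by rewrite eA /X -!mulmxA (mulmxA F) (mulmxA (F *m _)) mulmxV // mul1mx.
have eXA : X *m A = F^T *m P *m F.
  by rewrite eA /X -!mulmxA (mulmxA C^T) (mulmxA Q) mulVmx // mul1mx.
have sP : P^T = P by rewrite trmx_inv trmx_mul trmxK.
have sQ : Q^T = Q by rewrite trmx_inv trmx_mul trmxK.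
exists X; split.
- rewrite eAX eA -!mulmxA (mulmxA C^T) (mulmxA Q) mulVmx // mul1mx //.
- by rewrite eXA /X -!mulmxA (mulmxA F) (mulmxA P (F *m _)) mulVmx // mul1mx.
- by rewrite eAX !trmx_mul trmxK sQ mulmxA.
- by rewrite eXA !trmx_mul trmxK sP mulmxA.
Qed.

Definition basis_vec (R : realType) n (i : 'I_n) : 'cV[R]_n := delta_mx i 0.

(* All partial derivatives of order at most k exist and are continuous on U.
   Meaningful for open U: partial derivatives are two-sided, and continuity
   is continuity in the whole space at the points of U. *)
Fixpoint Ck_on (R : realType) n (k : nat) (U : set 'cV[R]_n)
    (f : 'cV[R]_n -> R) : Prop :=
  (forall x, U x -> {for x, continuous f}) /\
  if k is k'.+1 then
    forall i : 'I_n, (forall x, U x -> derivable f x (basis_vec R i)) /\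
                     Ck_on k' U ('D_(basis_vec R i) f)
  else True.

Definition hessian (R : realType) n (f : 'cV[R]_n -> R) (x : 'cV[R]_n)
    : 'M[R]_n :=
  \matrix_(i, j) 'D_(basis_vec R i) ('D_(basis_vec R j) f) x.

Definition lipschitz_constant (R : realType) n (U : set 'cV[R]_n)
    (H : 'cV[R]_n -> 'M[R]_n) (L : R) : Prop :=
  forall x y, U x -> U y -> spnorm (H x - H y) <= L * enorm (x - y).

(* A tuple of k directions in R^n is the matrix having them as columns. *)
Definition max_colnorm (R : realType) n k (T : 'M[R]_(n, k)) : R :=
  \big[Num.max/0]_(j < k) enorm (col j T).

Definition normalized (R : realType) n k (T : 'M[R]_(n, k)) : 'M[R]_(n, k) :=
  (max_colnorm T)^-1 *: T.

Definition delta_f (R : realType) n k (f : 'cV[R]_n -> R) (x : 'cV[R]_n)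
    (T : 'M[R]_(n, k)) : 'cV[R]_k :=
  \col_(j < k) (f (x + col j T) - f x).

Definition simplex_gradient (R : realType) n k (f : 'cV[R]_n -> R)
    (x : 'cV[R]_n) (T : 'M[R]_(n, k)) : 'cV[R]_n :=
  pinv T^T *m delta_f f x T.

Definition delta_gradient (R : realType) n m k (f : 'cV[R]_n -> R)
    (x : 'cV[R]_n) (S : 'M[R]_(n, m)) (T : 'M[R]_(n, k)) : 'M[R]_(m, n) :=
  \matrix_(i < m)
    (simplex_gradient f (x + col i S) T - simplex_gradient f x T)^T.

Definition nested_hessian (R : realType) n m k (f : 'cV[R]_n -> R)
    (x : 'cV[R]_n) (S : 'M[R]_(n, m)) (T : 'M[R]_(n, k)) : 'M[R]_n :=
  pinv S^T *m delta_gradient f x S T.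

(* All the points at which f is evaluated by [nested_hessian f x S T]. *)
Definition sample_points (R : realType) n m k (x : 'cV[R]_n)
    (S : 'M[R]_(n, m)) (T : 'M[R]_(n, k)) : set 'cV[R]_n :=
  [set y | [\/ y = x,
               exists i, y = x + col i S,
               exists j, y = x + col j T |
               exists i j, y = x + col i S + col j T]].

(* Main.v *)
Require Import Defs.
From HB Require Import structures.
From mathcomp Require Import all_boot all_order all_algebra.
From mathcomp Require Import boolp classical_sets reals topology normedtype.
From mathcomp Require Import derive.
From mathcomp Require Import realfun.
From mathcomp Require Import ring lra.

Set Implicit Arguments.
Unset Strict Implicit.
Unset Printing Implicit Defensive.

Import Order.TTheory GRing.Theory Num.Theory.
Import numFieldNormedType.Exports.

Local Open Scope classical_set_scope.
Local Open Scope ring_scope.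

(** With full row rank, [pinv S^T] and [pinv T^T] are left inverses of [S^T] and
    [T^T]. Writing [H] for the Hessian at [x0], the error of the nested-set
    Hessian is therefore [pinv S^T] times the matrix with rows

      [(pinv T^T ((delta_f (x0 + s^i) - delta_f x0) - T^T H^T s^i))^T],

    so that everything reduces to the scalar errors

      [f (x0 + s + t) - f (x0 + s) - f (x0 + t) + f x0 - s^T H t]

    with [s] and [t] columns of [S] and [T]. The mixed second difference formed
    by the first four terms is the integral of
    [s^T (hessian f (x0 + sigma s + tau t)) t] over the unit square, and the Lipschitz bound [L (sigma |s| + tau |t|)] for the variation
    of the Hessian integrates to [L |s| |t| (|s| + |t|) / 2]
    ([mixed_difference_le]). The four corners of the parallelogram are sample
    points, so that it lies in the ball by convexity. The integrals are replaced
    by a mean value argument with an affine bound on the derivative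
    ([norm_increment_le_affine]), used once in each direction; the directional
    derivatives come from the continuous partial derivatives through
    [is_derive_partials].

    The scalar errors are then collected: [k] entries give a factor [sqrt k]
    and the norm of [pinv T], [m] rows give a factor [sqrt m]
    ([spnorm_rows_le]) and the norm of [pinv S^T]. Normalizing [S] and [T] turns
    these norms into those of the theorem divided by the two radii, which
    cancel against the product [|s| |t|]; the remaining average of the radii is
    at most [Delta_u]. This proves the bound with the constant
    [sqrt m * sqrt k] ([nested_hessian_error]). It implies both inequalities,
    because [sqrt m <= m] and the numerical factors
    [(2 Delta_u / Delta_l + 3) / 3] and [5 / 3] are at least [1]. *)

(** * Euclidean norm *)

Lemma enorm_ge0 (R : realType) n (v : 'cV[R]_n) : 0 <= enorm v.
Proof. exact: sqrtr_ge0. Qed.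

Lemma enorm_sq (R : realType) n (v : 'cV[R]_n) :
  enorm v ^+ 2 = (v^T *m v) 0 0.
Proof.
rewrite sqr_sqrtr; last by apply: sumr_ge0 => i _; exact: sqr_ge0.
by rewrite mxE; apply: eq_bigr => i _; rewrite mxE expr2.
Qed.

Lemma enorm0 (R : realType) n : enorm (0 : 'cV[R]_n) = 0.
Proof. by apply/eqP; rewrite -sqrf_eq0 enorm_sq mulmx0 mxE. Qed.

Lemma enormZ (R : realType) n (a : R) (v : 'cV[R]_n) :
  enorm (a *: v) = `|a| * enorm v.
Proof.
rewrite /enorm -sqrtr_sqr -sqrtrM ?sqr_ge0// mulr_sumr.
by congr Num.sqrt; apply: eq_bigr => i _; rewrite mxE exprMn.
Qed.

Lemma enormN (R : realType) n (v : 'cV[R]_n) : enorm (- v) = enorm v.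
Proof. by rewrite -scaleN1r enormZ normrN1 mul1r. Qed.

Lemma enorm_eq0 (R : realType) n (v : 'cV[R]_n) : (enorm v == 0) = (v == 0).
Proof.
apply/eqP/eqP => [|->]; last exact: enorm0.
move=> /eqP; rewrite -sqrf_eq0 enorm_sq mxE.
rewrite psumr_eq0; last by move=> i _; rewrite mxE -expr2 sqr_ge0.
move=> /allP v0; apply/colP => i; have := v0 i (mem_index_enum i).
by rewrite /= !mxE -expr2 sqrf_eq0 => /eqP.
Qed.

Lemma enorm_gt0 (R : realType) n (v : 'cV[R]_n) : (0 < enorm v) = (v != 0).
Proof. by rewrite lt_def enorm_ge0 andbT enorm_eq0. Qed.

Lemma dotC (R : realType) n (u v : 'cV[R]_n) :
  (u^T *m v) 0 0 = (v^T *m u) 0 0.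
Proof. by rewrite !mxE; apply: eq_bigr => i _; rewrite !mxE mulrC. Qed.

(** Expanding the square of [|v|^2 u - (u.v) v], which is nonnegative, gives
    [|v|^2] times the difference of the two squared sides. *)
Lemma cauchy_schwarz (R : realType) n (u v : 'cV[R]_n) :
  (u^T *m v) 0 0 <= enorm u * enorm v.
Proof.
have [->|v0] := eqVneq v 0; first by rewrite mulmx0 mxE enorm0 mulr0.
rewrite (le_trans (ler_norm _))// -ler_sqr ?nnegrE ?mulr_ge0 ?enorm_ge0//.
rewrite real_normK ?num_real// exprMn.
set c := (u^T *m v) 0 0; have v_gt0 : 0 < enorm v ^+ 2.
  by rewrite exprn_gt0// enorm_gt0.
have mxB (A B : 'M[R]_1) : (A - B) 0 0 = A 0 0 - B 0 0 by rewrite !mxE.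
have mxZ (a : R) (A : 'M[R]_1) : (a *: A) 0 0 = a * A 0 0 by rewrite mxE.
have := sqr_ge0 (enorm (enorm v ^+ 2 *: u - c *: v)).
rewrite (enorm_sq (_ - _)) [(_ - _)^T]linearB/= mulmxBl !mulmxBr.
rewrite ![(_ *: _)^T]linearZ/= -!scalemxAl -!scalemxAr !(mxB, mxZ).
rewrite -!enorm_sq (dotC v u) -/c.
rewrite (_ : _ - _ =
  enorm v ^+ 2 * (enorm u ^+ 2 * enorm v ^+ 2 - c ^+ 2)); last by ring.
by rewrite pmulr_rge0// subr_ge0.
Qed.

Lemma mulmx_row_dot (R : realType) m n (A : 'M[R]_(m, n)) (v : 'cV[R]_n) i :
  (A *m v) i 0 = (((row i A)^T)^T *m v) 0 0.
Proof. by rewrite trmxK -row_mul [RHS]mxE. Qed.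

Lemma enormD (R : realType) n (u v : 'cV[R]_n) :
  enorm (u + v) <= enorm u + enorm v.
Proof.
have mxD (A B : 'M[R]_1) : (A + B) 0 0 = A 0 0 + B 0 0 by rewrite !mxE.
rewrite -ler_sqr ?nnegrE ?addr_ge0 ?enorm_ge0//.
rewrite (enorm_sq (u + v)) [(_ + _)^T]linearD/= mulmxDl !mulmxDr !mxD.
rewrite -!enorm_sq (dotC v u).
have := cauchy_schwarz u v; nra.
Qed.

Lemma enorm_le_sup (R : realType) n (v : 'cV[R]_n) (c : R) : 0 <= c ->
  (forall i, `|v i 0| <= c) -> enorm v <= Num.sqrt n%:R * c.
Proof.
move=> c0 vc; rewrite -[c in leRHS]ger0_norm// -sqrtr_sqr -sqrtrM// ler_sqrt.
  rewrite mulr_natl -[n in _ *+ n]card_ord -sumr_const; apply: ler_sum => i _.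
  by rewrite -real_normK ?num_real// lerXn2r ?nnegrE.
by rewrite mulr_ge0 ?sqr_ge0.
Qed.

Lemma eball_open (R : realType) n (x : 'cV[R]_n) (r : R) : open (eball x r).
Proof.
have cont : continuous (fun y : 'cV[R]_n => enorm (y - x)).
  move=> y; apply: (@continuous_comp _ _ _
    (fun y : 'cV[R]_n => \sum_(i < n) (y - x) i 0 ^+ 2) Num.sqrt);
    last exact: sqrt_continuous.
  apply: (@continuous_big R 'I_n +%R 0 xpredT add_continuous) => i _ {}y.
  have cont_i : {for y, continuous (fun z : 'cV[R]_n => z i 0 - x i 0)}.
    apply: continuousB; last exact: cst_continuous.
    exact: (@coord_continuous R n 1 i 0 y).
  rewrite (_ : (fun _ => _) =
      (fun z : 'cV[R]_n => (z i 0 - x i 0) * (z i 0 - x i 0))).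
    exact: (continuousM cont_i cont_i).
  by apply/funext => z; rewrite !mxE expr2.
rewrite (_ : eball x r = (fun y => enorm (y - x)) @^-1` [set t | t < r]) //.
by apply: open_comp => [y _|]; [exact: cont|exact: open_lt].
Qed.

Lemma eball_segment (R : realType) n (x p v : 'cV[R]_n) (r t : R) :
  0 <= t <= 1 -> eball x r p -> eball x r (p + v) -> eball x r (p + t *: v).
Proof.
move=> /andP[t0 t1]; rewrite /eball/= => xp xpv.
have -> : p + t *: v - x = (1 - t) *: (p - x) + t *: (p + v - x).
  by apply/matrixP => i j; rewrite !mxE; ring.
rewrite (le_lt_trans (enormD _ _))// !enormZ !ger0_norm ?subr_ge0//.
move: t0; rewrite le_eqVlt => /predU1P[<-|t0].
  by rewrite subr0 mul1r mul0r addr0.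
nra.
Qed.

(** * Spectral norm *)

(** The supremum defining [spnorm] is meaningful only for a bounded set; the
    entries of [A v] are controlled by the rows of [A] through
    Cauchy-Schwarz. *)
Lemma spnorm_has_ubound (R : realType) m n (A : 'M[R]_(m, n)) :
  has_ubound [set enorm (A *m v) | v in [set v : 'cV[R]_n | enorm v <= 1]].
Proof.
exists (Num.sqrt m%:R * (\sum_i enorm (row i A)^T)) => _ [v /= v1 <-].
apply: enorm_le_sup => [|i]; first by rewrite sumr_ge0// => *; exact: enorm_ge0.
have rowA : enorm (row i A)^T <= \sum_i enorm (row i A)^T.
  by rewrite (bigD1 i)//= lerDl sumr_ge0// => *; exact: enorm_ge0.
have bnd w : enorm w <= 1 -> (A *m w) i 0 <= \sum_i enorm (row i A)^T.
  move=> w1; rewrite mulmx_row_dot; apply: le_trans rowA.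
  by rewrite (le_trans (cauchy_schwarz _ _))// ler_piMr ?enorm_ge0.
rewrite ler_norml bnd// andbT lerNl.
by have := bnd (- v); rewrite mulmxN mxE enormN => /(_ v1).
Qed.

Lemma spnorm_ge0 (R : realType) m n (A : 'M[R]_(m, n)) : 0 <= spnorm A.
Proof.
apply: ub_le_sup; first exact: spnorm_has_ubound.
by exists 0; rewrite /= ?mulmx0 enorm0.
Qed.

Lemma enorm_mulmx_le (R : realType) m n (A : 'M[R]_(m, n)) (v : 'cV[R]_n) :
  enorm (A *m v) <= spnorm A * enorm v.
Proof.
have [->|v0] := eqVneq v 0; first by rewrite mulmx0 !enorm0 mulr0.
have v_gt0 : 0 < enorm v by rewrite enorm_gt0.
rewrite -ler_pdivrMr//; apply: ub_le_sup; first exact: spnorm_has_ubound.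
exists ((enorm v)^-1 *: v).
  by rewrite /= enormZ gtr0_norm ?invr_gt0// mulVf// gt_eqF.
by rewrite -scalemxAr enormZ gtr0_norm ?invr_gt0// mulrC.
Qed.

Lemma spnorm_le (R : realType) m n (A : 'M[R]_(m, n)) (c : R) : 0 <= c ->
  (forall v : 'cV[R]_n, enorm (A *m v) <= c * enorm v) -> spnorm A <= c.
Proof.
move=> c0 Ac; apply: ge_sup => [|_ [v /= v1 <-]].
  by exists (enorm (A *m 0)), 0; rewrite /= ?enorm0.
by rewrite (le_trans (Ac v))// ler_piMr.
Qed.

(** From [|A^T v|^2 = v . A A^T v], bounded by [|v| ||A|| |A^T v|]. *)
Lemma spnorm_tr_le (R : realType) m n (A : 'M[R]_(m, n)) :
  spnorm A^T <= spnorm A.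
Proof.
apply: spnorm_le => [|v]; first exact: spnorm_ge0.
have [->|Av] := eqVneq (A^T *m v) 0.
  by rewrite enorm0 mulr_ge0 ?spnorm_ge0 ?enorm_ge0.
rewrite -(ler_pM2r (_ : 0 < enorm (A^T *m v))) ?enorm_gt0// -expr2 enorm_sq.
rewrite trmx_mul trmxK -mulmxA (le_trans (cauchy_schwarz _ _))//.
rewrite mulrAC [leRHS]mulrC; apply: ler_wpM2l; first exact: enorm_ge0.
exact: enorm_mulmx_le.
Qed.

Lemma spnormZ_le (R : realType) m n (a : R) (A : 'M[R]_(m, n)) :
  spnorm (a *: A) <= `|a| * spnorm A.
Proof.
apply: spnorm_le => [|v]; first by rewrite mulr_ge0 ?spnorm_ge0.
rewrite -scalemxAl enormZ -mulrA ler_wpM2l//; exact: enorm_mulmx_le.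
Qed.

Lemma spnormM_le (R : realType) m n p (A : 'M[R]_(m, n)) (B : 'M[R]_(n, p)) :
  spnorm (A *m B) <= spnorm A * spnorm B.
Proof.
apply: spnorm_le => [|v]; first by rewrite mulr_ge0 ?spnorm_ge0.
rewrite -mulmxA (le_trans (enorm_mulmx_le _ _))// -mulrA.
by rewrite ler_wpM2l ?spnorm_ge0 ?enorm_mulmx_le.
Qed.

(** This is how a bound on the error at each sample [s^i] becomes a bound on
    the whole error matrix. *)
Lemma spnorm_rows_le (R : realType) m n (A : 'M[R]_(m, n)) (c : R) : 0 <= c ->
  (forall i, enorm (row i A)^T <= c) -> spnorm A <= Num.sqrt m%:R * c.
Proof.
move=> c0 rowA; apply: spnorm_le => [|v]; first by rewrite mulr_ge0 ?sqrtr_ge0.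
rewrite -mulrA.
have bnd i w : (A *m w) i 0 <= c * enorm w.
  rewrite mulmx_row_dot (le_trans (cauchy_schwarz _ _))//.
  by rewrite ler_wpM2r ?enorm_ge0.
apply: enorm_le_sup => [|i]; first by rewrite mulr_ge0 ?enorm_ge0.
rewrite ler_norml bnd// andbT lerNl.
by have := bnd i (- v); rewrite mulmxN mxE enormN.
Qed.

Lemma spnorm0 (R : realType) m n : spnorm (0 : 'M[R]_(m, n)) = 0.
Proof.
apply/eqP; rewrite eq_le spnorm_ge0 andbT.
by apply: spnorm_le => // v; rewrite mul0mx enorm0 mul0r.
Qed.

(** * Moore-Penrose inverse *)

Lemma pinv_tr (R : realType) m n (A : 'M[R]_(m, n)) : pinv A^T = (pinv A)^T.
Proof.
apply: penrose_uniq (pinvP _) _; have [X1 X2 X3 X4] := pinvP A.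
split; rewrite -!trmx_mul ?mulmxA ?trmxK ?X1 ?X2//.
Qed.

Lemma pinvZ (R : realType) m n (a : R) (A : 'M[R]_(m, n)) : a != 0 ->
  pinv (a *: A) = a^-1 *: pinv A.
Proof.
move=> a0; apply: penrose_uniq (pinvP _) _; have [X1 X2 X3 X4] := pinvP A.
have eAX : (a *: A) *m (a^-1 *: pinv A) = A *m pinv A.
  by rewrite -scalemxAl -scalemxAr scalerA mulfV// scale1r.
have eXA : (a^-1 *: pinv A) *m (a *: A) = pinv A *m A.
  by rewrite -scalemxAl -scalemxAr scalerA mulVf// scale1r.
split; rewrite ?eAX ?eXA ?X3 ?X4// -scalemxAr ?X1 ?X2//.
Qed.

Lemma pinv_tr_mul (R : realType) m n (A : 'M[R]_(m, n)) :
  row_free A -> pinv A^T *m A^T = 1%:M.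
Proof.
move=> Af; have [X1 _ _ _] := pinvP A.
rewrite pinv_tr -trmx_mul -(trmx1 R m); congr (_^T).
by apply: (row_free_inj Af); rewrite X1 mul1mx.
Qed.

(** * Directional derivatives from partial derivatives *)

(** Both sides are limits of the same difference quotient; this transports
    one-variable calculus to directional derivatives. *)
Lemma is_derive_line (R : realType) (V : normedModType R) (f : V -> R)
    (x v : V) (t d : R) :
  is_derive (x + t *: v) v f d <->
  is_derive t 1 (fun s : R => f (x + s *: v)) d.
Proof.
have eq_quot : (fun h : R => h^-1 *:
      ((f \o shift (x + t *: v)) (h *: v) - f (x + t *: v))) =
    (fun h : R => h^-1 *: (((fun s : R => f (x + s *: v)) \o shift t) (h *: 1)
      - f (x + t *: v))).
  apply/funext => h /=; rewrite [h *: 1]mulr1 scalerDl.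
  by rewrite addrCA.
by split=> -[dv dE]; split; move: dv dE; rewrite /derivable /derive eq_quot.
Qed.

Lemma is_derive_scale (R : realType) (V : normedModType R) (f : V -> R)
    (x v : V) (k d : R) :
  is_derive x v f d -> is_derive x (k *: v) f (k * d).
Proof.
move=> dv.
have dg : is_derive (0 : R) 1 (fun s : R => f (x + s *: v)) d.
  by apply/(@is_derive_line R V f x v 0 d); rewrite scale0r addr0.
have dk : is_derive (0 : R) 1 (fun s : R => k * s) k.
  have := @is_deriveZ R R R id k 0 1 1 (is_derive_id (0 : R) (1 : R)).
  by rewrite [k *: _]mulr1.
rewrite -[x]addr0 -(scale0r (k *: v)).
apply/(@is_derive_line R V f x (k *: v) 0 (k * d)).
rewrite (_ : (fun s => _) =
    (fun s : R => f (x + s *: v)) \o (fun s : R => k * s)).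
  rewrite mulrC; apply: is_derive1_comp dk.
  by rewrite mulr0.
by apply/funext => s /=; rewrite scalerA mulrC.
Qed.

Lemma MVT_dir (R : realType) (V : normedModType R) (f : V -> R) (x v : V) :
  (forall t : R, 0 <= t <= 1 -> derivable f (x + t *: v) v) ->
  exists2 t : R, 0 <= t <= 1 & f (x + v) - f x = 'D_v f (x + t *: v).
Proof.
move=> dv; pose g (t : R) := f (x + t *: v).
have dg (t : R) : 0 <= t <= 1 -> is_derive t 1 g ('D_v f (x + t *: v)).
  move=> t01; apply/(@is_derive_line R V f x v t ('D_v f (x + t *: v))).
  by apply/derivableP/dv.
have [||t t01] := @MVT_segment _ g
    (fun t : R => 'D_v f (x + t *: v)) 0 1 ler01.
- move=> t; rewrite in_itv/= => t01.
  by apply: dg; case/andP: t01 => ? ?; rewrite !ltW.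
- apply: derivable_within_continuous => t; rewrite in_itv/= => t01.
  exact: (@ex_derive _ _ _ _ _ _ _ (dg t t01)).
- rewrite subr0 mulr1 /g scale0r addr0 scale1r => ->; exists t => //.
Qed.

(** Writing the increment along [h (u + v)] as the increment along [h u]
    followed by the one along [h v], the first gives [d] in the limit, and the
    mean value theorem turns the second into [h] times a value of ['D_v f] at
    a point that tends to [x], so that continuity of ['D_v f] concludes. *)
Lemma is_derive_add (R : realType) (V : normedModType R) (U : set V)
    (f : V -> R) (x u v : V) (d : R) :
  open U -> U x -> is_derive x u f d ->
  (forall y, U y -> derivable f y v) -> {for x, continuous ('D_v f)} ->
  is_derive x (u + v) f (d + 'D_v f x).
Proof.
move=> Uo Ux du dv cv.
suff cvg_uv : h^-1 *: ((f \o shift x) (h *: (u + v)) - f x) @[h --> 0^']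
    --> d + 'D_v f x.
  split; first by apply/cvg_ex; exists (d + 'D_v f x).
  exact: cvg_lim.
have cvg_u : h^-1 *: ((f \o shift x) (h *: u) - f x) @[h --> 0^'] --> d.
  by have [+ <-] := du.
suff cvg_v : h^-1 *: (f (x + h *: u + h *: v) - f (x + h *: u)) @[h --> 0^']
    --> 'D_v f x.
  rewrite (_ : (fun h => _) = (fun h : R =>
      h^-1 *: ((f \o shift x) (h *: u) - f x) +
      h^-1 *: (f (x + h *: u + h *: v) - f (x + h *: u)))).
    exact: cvgD.
  apply/funext => h /=; rewrite -scalerDr; congr (_ *: _).
  rewrite scalerDr (addrC (h *: u) x) (addrC _ x) addrA.
  by rewrite [RHS]addrC addrA subrK.
apply/cvgrPdist_le => e e0.
have [r /= r0 rU] : exists2 r : R, 0 < r & forall y, `|x - y| < r ->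
    U y /\ `|'D_v f x - 'D_v f y| <= e.
  have : \forall y \near x, U y /\ `|'D_v f x - 'D_v f y| <= e.
    near=> y; split; first by near: y; exact: open_nbhs_nbhs.
    by near: y; move/cvgrPdist_le : cv; exact.
  by move=> /nbhs_ballP[r /= r0 rU]; exists r => // y xy;
    apply: rU; rewrite -ball_normE.
(* [|h| c] bounds the norm of [h u + tau h v] for [tau] in the unit interval;
   the [1] keeps [c] positive when [u] and [v] vanish. *)
pose c := `|u| + `|v| + 1.
have c0 : 0 < c by rewrite ltr_wpDl ?addr_ge0.
near=> h.
have h0 : h != 0 by near: h; exact: nbhs_dnbhs_neq.
have hc : `|h| * c < r.
  rewrite -ltr_pdivlMr//; near: h; apply: dnbhs0_lt; exact: divr_gt0.
have near_x (t : R) : 0 <= t <= 1 -> `|x - (x + h *: u + t *: (h *: v))| < r.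
  move=> /andP[t0 t1]; apply: le_lt_trans hc.
  rewrite opprD opprD addrA addrA subrr sub0r -opprD normrN.
  rewrite scalerA mulrC -scalerA -scalerDr normrZ.
  rewrite ler_wpM2l// (le_trans (ler_normD _ _))// /c -addrA lerD2l.
  rewrite normrZ ger0_norm//.
  by rewrite -[leLHS]addr0 lerD// ler_piMl.
have dhv (t : R) : 0 <= t <= 1 ->
    is_derive (x + h *: u + t *: (h *: v)) (h *: v) f
      (h * 'D_v f (x + h *: u + t *: (h *: v))).
  move=> t01; apply: is_derive_scale; apply/derivableP/dv.
  by have [] := rU _ (near_x t t01).
have [t t01 ->] := MVT_dir (fun t t01 => @ex_derive _ _ _ _ _ _ _ (dhv t t01)).
rewrite (@derive_val _ _ _ _ _ _ _ (dhv t t01)) [_ *: _]mulrA mulVf// mul1r.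
by have [] := rU _ (near_x t t01).
Unshelve. all: by end_near. Qed.

(** The coordinates of [v] are added to the direction one at a time by
    [is_derive_add]. *)
Lemma is_derive_partials (R : realType) n (U : set 'cV[R]_n) (f : 'cV[R]_n -> R)
    (x v : 'cV[R]_n) :
  open U -> U x -> Ck_on 1 U f ->
  is_derive x v f (\sum_i v i 0 * 'D_(basis_vec R i) f x).
Proof.
move=> Uo Ux [_ f_C1].
have df i y : U y -> derivable f y (basis_vec R i).
  by case: (f_C1 i) => + _; exact.
have cf i : {for x, continuous ('D_(basis_vec R i) f)}.
  by case: (f_C1 i) => _ [+ _]; exact.
pose a i := v i 0.
have vE : v = \sum_i a i *: basis_vec R i.
  apply/colP => j; rewrite summxE (bigD1 j)//= big1 ?addr0 => [|i ij].
    by rewrite !mxE !eqxx mulr1.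
  by rewrite !mxE eq_sym (negbTE ij) mulr0.
suff : is_derive x (\sum_i a i *: basis_vec R i) f
    (\sum_i a i * 'D_(basis_vec R i) f x) by rewrite -vE.
elim/big_rec2: _ => [|i w d _ IH]; first exact: is_derive0.
have dscale (y : 'cV[R]_n) : U y ->
    is_derive y (a i *: basis_vec R i) f (a i * 'D_(basis_vec R i) f y).
  by move=> Uy; apply: is_derive_scale; apply/derivableP/df.
have DE y : U y ->
    'D_(a i *: basis_vec R i) f y = a i * 'D_(basis_vec R i) f y.
  by move=> Uy; rewrite (@derive_val _ _ _ _ _ _ _ (dscale y Uy)).
rewrite addrC [X in is_derive _ _ _ X]addrC -DE//.
apply: (is_derive_add Uo Ux IH) => [y Uy|].
  exact: (@ex_derive _ _ _ _ _ _ _ (dscale y Uy)).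
suff : 'D_(a i *: basis_vec R i) f y @[y --> x] -->
    a i * 'D_(basis_vec R i) f x.
  by rewrite -(DE x Ux).
have : a i * 'D_(basis_vec R i) f y @[y --> x] --> a i * 'D_(basis_vec R i) f x.
  exact: (cvgM (cvg_cst (a i)) (cf i)).
move=> h; apply: cvg_trans h; apply: (@near_eq_cvg _ _ (nbhs x)).
near=> y; rewrite DE//.
by near: y; exact: open_nbhs_nbhs.
Unshelve. all: by end_near. Qed.

(** * Mixed second differences *)

Lemma Ck_onS (R : realType) n k (U : set 'cV[R]_n) (f : 'cV[R]_n -> R) :
  Ck_on k.+1 U f -> Ck_on k U f.
Proof.
elim: k f => [f [cf _]|k IH f [cf f_CSk]]; first by split.
by split=> // i; have [df /IH] := f_CSk i.
Qed.

(** Mean value theorem for [g] minus the antiderivative [a t + b t^2 / 2] of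
    the affine bound. It keeps the factor [1 / 2] of the linear part, which the
    mean value theorem applied to [g] itself would lose. *)
Lemma increment_le_affine (R : realType) (g dg : R -> R) (a b : R) :
  (forall t : R, 0 <= t <= 1 -> is_derive t 1 g (dg t)) ->
  (forall t : R, 0 <= t <= 1 -> dg t <= a + b * t) ->
  g 1 - g 0 <= a + b / 2.
Proof.
move=> dgP dg_le; pose p : {poly R} := a *: 'X + (b / 2) *: 'X^2.
have dp t : p^`().[t] = a + b * t.
  by rewrite /p !poly.derivE !hornerE/= -mulr_natr; field.
have [||t] := @MVT_segment _ (g \- horner p)
    (fun t : R => dg t - p^`().[t]) 0 1 ler01.
- move=> t; rewrite in_itv/= => /andP[t0 t1].
  apply: (@is_deriveB R R R g (horner p) t 1).
  by apply: dgP; rewrite !ltW.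
- apply: derivable_within_continuous => t; rewrite in_itv/= => t01.
  apply: (@derivableB R R R g (horner p) t 1); last exact: derivable_horner.
  exact: (@ex_derive _ _ _ _ _ _ _ (dgP t t01)).
- rewrite in_itv/= => /dg_le; rewrite dp subr0 mulr1.
  rewrite /= /p !hornerE/= => h e.
  rewrite -subr_le0; move: e; lra.
Qed.

Lemma norm_increment_le_affine (R : realType) (g dg : R -> R) (q a b : R) :
  (forall t : R, 0 <= t <= 1 -> is_derive t 1 g (dg t)) ->
  (forall t : R, 0 <= t <= 1 -> `|dg t - q| <= a + b * t) ->
  `|g 1 - g 0 - q| <= a + b / 2.
Proof.
move=> dgP dg_le; have dg_bounds t : 0 <= t <= 1 ->
    - (a + b * t) <= dg t - q /\ dg t - q <= a + b * t.
  by move=> /dg_le; rewrite ler_norml => /andP.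
rewrite ler_norml; apply/andP; split.
  have : (\- g) 1 - (\- g) 0 <= (a - q) + b / 2.
    apply: (@increment_le_affine _ (\- g) (\- dg)) => t t01.
      by apply: is_deriveN; exact: dgP.
    rewrite /=; have [] := dg_bounds t t01; lra.
  rewrite /=; lra.
have : g 1 - g 0 <= (a + q) + b / 2; last by lra.
by apply: increment_le_affine dgP _ => t /dg_bounds[]; lra.
Qed.

Lemma bilinear_form_le (R : realType) n (A : 'M[R]_n) (u v : 'cV[R]_n) :
  `|(u^T *m A *m v) 0 0| <= spnorm A * enorm u * enorm v.
Proof.
have le_form w : (w^T *m A *m v) 0 0 <= spnorm A * enorm w * enorm v.
  rewrite -mulmxA (le_trans (cauchy_schwarz _ _))// mulrAC [leRHS]mulrC.
  by rewrite ler_wpM2l ?enorm_ge0 ?enorm_mulmx_le.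
rewrite ler_norml le_form andbT lerNl -(enormN u).
by apply: le_trans (le_form (- u)); rewrite linearN/= !mulNmx [leRHS]mxE.
Qed.

(** The sum is the derivative of [f] in the direction [t], so this is its
    second derivative in the directions [t], then [s]; the derivative along [s]
    of each partial derivative is again given by [is_derive_partials]. *)
Lemma is_derive_directional (R : realType) n (U : set 'cV[R]_n)
    (f : 'cV[R]_n -> R) (x s t : 'cV[R]_n) :
  open U -> U x -> Ck_on 2 U f ->
  is_derive x s (fun y => \sum_j t j 0 * 'D_(basis_vec R j) f y)
    ((s^T *m hessian f x *m t) 0 0).
Proof.
move=> Uo Ux [_ f_C2].
have dj j : is_derive x s (t j 0 \*: 'D_(basis_vec R j) f)
    (t j 0 *: \sum_i s i 0 * 'D_(basis_vec R i) ('D_(basis_vec R j) f) x).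
  by apply: is_deriveZ; apply: is_derive_partials Uo Ux _; case: (f_C2 j).
have := is_derive_sum dj; congr is_derive.
  by apply/funext => y; rewrite functions.fct_sumE.
rewrite mxE; apply: eq_bigr => j _; rewrite mxE [RHS]mulrC; congr (_ * _).
by apply: eq_bigr => i _; rewrite !mxE.
Qed.

(** The increment in the direction [t] of [f (. + s) - f] is estimated from its
    derivative, which is itself an increment in the direction [s] of the
    directional derivative [G] of [f]. The Hessian at [x + tau t + sigma s]
    differs from the one at [x] by at most [L (tau |t| + sigma |s|)]: this
    bound is affine in [sigma] and, once [sigma] is integrated out, affine in
    [tau]. *)
Lemma mixed_difference_le (R : realType) n (f : 'cV[R]_n -> R)
    (x s t : 'cV[R]_n) (r L : R) :
  Ck_on 2 (eball x r) f ->
  lipschitz_constant (eball x r) (hessian f) L ->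
  0 <= L ->
  eball x r x -> eball x r (x + s) -> eball x r (x + t) ->
  eball x r (x + s + t) ->
  `|(f (x + s + t) - f (x + s)) - (f (x + t) - f x)
    - (s^T *m hessian f x *m t) 0 0|
  <= L * enorm s * enorm t * ((enorm s + enorm t) / 2).
Proof.
move=> f_C2 L_lip L0 Ux Us Ut Ust; set U := eball x r in Ux Us Ut Ust *.
have Uo : open U by exact: eball_open.
have f_C1 := Ck_onS f_C2.
set q := (s^T *m hessian f x *m t) 0 0.
pose G y := \sum_j t j 0 * 'D_(basis_vec R j) f y.
have dG y : U y -> is_derive y s G ((s^T *m hessian f y *m t) 0 0).
  by move=> Uy; exact: is_derive_directional f_C2.
have df y : U y -> is_derive y t f (G y).
  by move=> Uy; exact: is_derive_partials f_C1.
have Utau tau : 0 <= tau <= 1 -> U (x + tau *: t).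
  by move=> tau01; exact: eball_segment.
have Ustau tau : 0 <= tau <= 1 -> U (x + s + tau *: t).
  by move=> tau01; exact: eball_segment.
(* First level: [tau] is fixed and [sigma] runs over the unit interval. *)
have inner tau : 0 <= tau <= 1 ->
    `|G (x + s + tau *: t) - G (x + tau *: t) - q| <=
      (L * enorm s * enorm t * enorm t) * tau +
      (L * enorm s * enorm t * enorm s) / 2.
  move=> tau01; pose y (sigma : R) := x + tau *: t + sigma *: s.
  have Uy sigma : 0 <= sigma <= 1 -> U (y sigma).
    move=> sigma01; apply: eball_segment => //; first exact: Utau.
    by rewrite addrAC; exact: Ustau.
  have -> : G (x + s + tau *: t) - G (x + tau *: t) = G (y 1) - G (y 0).
    by rewrite /y scale0r addr0 scale1r (addrAC x).
  apply: (@norm_increment_le_affine _ (G \o y)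
    (fun sigma => (s^T *m hessian f (y sigma) *m t) 0 0)) => sigma sigma01.
    apply/(@is_derive_line R _ G (x + tau *: t) s sigma).
    by apply: dG; exact: Uy.
  have [/andP[tau0 _] /andP[sigma0 _]] := (tau01, sigma01).
  have -> : (s^T *m hessian f (y sigma) *m t) 0 0 - q =
      (s^T *m (hessian f (y sigma) - hessian f x) *m t) 0 0.
    by rewrite mulmxBr mulmxBl [RHS]mxE; congr (_ + _); rewrite [RHS]mxE.
  rewrite (le_trans (bilinear_form_le _ _ _))//.
  have yx : enorm (y sigma - x) <= tau * enorm t + sigma * enorm s.
    rewrite /y [_ - x]addrC -addrA addKr (le_trans (enormD _ _))//.
    by rewrite !enormZ !ger0_norm.
  rewrite [leRHS](_ : _ =
      L * (tau * enorm t + sigma * enorm s) * enorm s * enorm t); last by ring.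
  rewrite !ler_wpM2r ?enorm_ge0// (le_trans (L_lip _ _ (Uy _ sigma01) Ux))//.
  by rewrite ler_wpM2l.
pose g (tau : R) := f (x + s + tau *: t) - f (x + tau *: t).
have -> : f (x + s + t) - f (x + s) - (f (x + t) - f x) = g 1 - g 0.
  by rewrite /g !scale0r !addr0 !scale1r !opprB; ring.
rewrite [leRHS](_ : _ = (L * enorm s * enorm t * enorm s) / 2 +
    (L * enorm s * enorm t * enorm t) / 2); last by field.
apply: (@norm_increment_le_affine _ g
  (fun tau => G (x + s + tau *: t) - G (x + tau *: t))) => tau tau01.
  apply: (@is_deriveB _ _ _ (fun tau : R => f (x + s + tau *: t))
    (fun tau : R => f (x + tau *: t))).
    by apply/(@is_derive_line R _ f (x + s) t tau); apply: df; exact: Ustau.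
  by apply/(@is_derive_line R _ f x t tau); apply: df; exact: Utau.
by rewrite [leRHS]addrC; exact: inner.
Qed.

(** * Error of the nested-set Hessian *)

Lemma max_colnorm_ge (R : realType) n k (T : 'M[R]_(n, k)) j :
  enorm (col j T) <= max_colnorm T.
Proof. exact: (le_bigmax_cond _ (fun j => enorm (col j T))). Qed.

Lemma max_colnorm_ge0 (R : realType) n k (T : 'M[R]_(n, k)) :
  0 <= max_colnorm T.
Proof.
rewrite /max_colnorm; elim/big_ind: _ => // [x y|j _]; last exact: enorm_ge0.
by rewrite le_max => ->.
Qed.

(** A row-free matrix with at least one row is nonzero. *)
Lemma max_colnorm_gt0 (R : realType) n k (T : 'M[R]_(n, k)) :
  (0 < n)%N -> row_free T -> 0 < max_colnorm T.
Proof.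
move=> n0 Tf; rewrite lt_def max_colnorm_ge0 andbT; apply/eqP => T0.
have : T = 0.
  apply/matrixP => i j; have := max_colnorm_ge T j.
  rewrite T0 => Tj; have /eqP : enorm (col j T) == 0.
    by rewrite eq_le Tj enorm_ge0.
  move=> /eqP; rewrite enorm_eq0 => /eqP /matrixP /(_ i 0).
  by rewrite !mxE.
move: Tf => /[swap] ->; rewrite /row_free mxrank0 => /eqP n0'.
by rewrite -n0' in n0.
Qed.

Lemma pinv_normalized (R : realType) n k (T : 'M[R]_(n, k)) :
  0 < max_colnorm T -> pinv (normalized T) = max_colnorm T *: pinv T.
Proof. by move=> T0; rewrite pinvZ ?invrK// invr_eq0 gt_eqF. Qed.

(** In positive dimension the ball has a point other than its centre. *)
Lemma lipschitz_constant_ge0 (R : realType) n (x : 'cV[R]_n) (r L : R)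
    (H : 'cV[R]_n -> 'M[R]_n) :
  (0 < n)%N -> 0 < r -> lipschitz_constant (eball x r) H L -> 0 <= L.
Proof.
move=> n0 r0 L_lip; pose e := const_mx 1 : 'cV[R]_n.
have e0 : 0 < enorm e.
  rewrite enorm_gt0; apply/eqP => /matrixP /(_ (Ordinal n0) 0).
  by rewrite !mxE => /eqP; rewrite oner_eq0.
pose y := x + (r / 2 / enorm e) *: e.
have yx : enorm (y - x) = r / 2.
  rewrite /y addrC addKr enormZ ger0_norm ?divr_ge0 ?enorm_ge0 ?ltW//.
  by rewrite divfK// gt_eqF.
have Ux : eball x r x by rewrite /eball/= subrr enorm0.
have Uy : eball x r y by rewrite /eball/= yx; lra.
have := le_trans (spnorm_ge0 _) (L_lip _ _ Uy Ux).
by rewrite yx pmulr_lge0// divr_gt0.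
Qed.

(** As [pinv T^T] is a left inverse of [T^T], the error is [pinv T^T] applied
    to the vector of the errors [f (x + s + t^j) - f (x + s) - f (x + t^j)
    + f x - s^T H t^j], each bounded by [mixed_difference_le]. *)
Lemma simplex_gradient_difference_error (R : realType) n k (f : 'cV[R]_n -> R)
    (x s : 'cV[R]_n) (T : 'M[R]_(n, k)) (r L c : R) :
  Ck_on 2 (eball x r) f -> lipschitz_constant (eball x r) (hessian f) L ->
  0 <= L -> row_free T -> enorm s <= c ->
  eball x r x -> eball x r (x + s) ->
  (forall j, eball x r (x + col j T)) ->
  (forall j, eball x r (x + s + col j T)) ->
  enorm (simplex_gradient f (x + s) T - simplex_gradient f x T
    - (hessian f x)^T *m s) <=
  spnorm (pinv T) * (Num.sqrt k%:R *
    (L * c * max_colnorm T * ((c + max_colnorm T) / 2))).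
Proof.
move=> f_C2 L_lip L0 T_full sc Ux Us Ut Ust.
have -> : simplex_gradient f (x + s) T - simplex_gradient f x T
    - (hessian f x)^T *m s =
    pinv T^T *m (delta_f f (x + s) T - delta_f f x T
      - T^T *m ((hessian f x)^T *m s)).
  by rewrite !mulmxBr (mulmxA _ T^T) pinv_tr_mul// mul1mx.
have c0 : 0 <= c := le_trans (enorm_ge0 s) sc.
have d0 := max_colnorm_ge0 T.
rewrite pinv_tr (le_trans (enorm_mulmx_le _ _))//.
apply: ler_pM; rewrite ?spnorm_ge0 ?enorm_ge0 ?spnorm_tr_le//.
apply: enorm_le_sup => [|j].
  by rewrite !mulr_ge0 ?addr_ge0 ?invr_ge0.
have -> : (delta_f f (x + s) T - delta_f f x T
      - T^T *m ((hessian f x)^T *m s)) j 0 =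
    f (x + s + col j T) - f (x + s) - (f (x + col j T) - f x)
    - (s^T *m hessian f x *m col j T) 0 0.
  have -> : T^T *m ((hessian f x)^T *m s) = (s^T *m hessian f x *m T)^T.
    by rewrite !trmx_mul trmxK.
  have -> : (s^T *m hessian f x *m col j T) 0 0 =
      (s^T *m hessian f x *m T) 0 j.
    rewrite [LHS]mxE [RHS]mxE.
    by apply: eq_bigr => p _; rewrite [col j T _ _]mxE.
  by move: (s^T *m _ *m T) => A; rewrite !mxE.
rewrite (le_trans (mixed_difference_le f_C2 L_lip L0 Ux Us (Ut j) (Ust j)))//.
have Tj := max_colnorm_ge T j.
have avg_ge0 : 0 <= (enorm s + enorm (col j T)) / 2.
  by rewrite divr_ge0 ?addr_ge0 ?enorm_ge0.
rewrite -!mulrA ler_wpM2l// ler_pM ?(mulr_ge0 (enorm_ge0 _) avg_ge0) ?enorm_ge0//.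
by rewrite ler_pM ?enorm_ge0// ler_wpM2r ?invr_ge0 ?lerD.
Qed.

(** As [pinv S^T] is a left inverse of [S^T], the error is [pinv S^T] times the
    matrix whose rows are the errors of
    [simplex_gradient_difference_error]. *)
Lemma nested_hessian_error (R : realType) n m k (f : 'cV[R]_n -> R)
    (x : 'cV[R]_n) (S : 'M[R]_(n, m)) (T : 'M[R]_(n, k)) (r L : R) :
  Ck_on 2 (eball x r) f -> lipschitz_constant (eball x r) (hessian f) L ->
  0 <= L -> row_free S -> row_free T ->
  0 < max_colnorm S -> 0 < max_colnorm T ->
  sample_points x S T `<=` eball x r ->
  spnorm (nested_hessian f x S T - hessian f x) <=
  Num.sqrt m%:R * Num.sqrt k%:R * L *
  spnorm (pinv (normalized S)^T) * spnorm (pinv (normalized T)) *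
  Num.max (max_colnorm S) (max_colnorm T).
Proof.
move=> f_C2 L_lip L0 S_full T_full dS dT samples.
have Ux : eball x r x by apply: samples; constructor 1.
have Us i : eball x r (x + col i S) by apply: samples; constructor 2; exists i.
have Ut j : eball x r (x + col j T) by apply: samples; constructor 3; exists j.
have Ust i j : eball x r (x + col i S + col j T).
  by apply: samples; constructor 4; exists i, j.
have -> : nested_hessian f x S T - hessian f x =
    pinv S^T *m (delta_gradient f x S T - S^T *m hessian f x).
  by rewrite mulmxBr mulmxA pinv_tr_mul// mul1mx.
set ds := max_colnorm S in dS *; set dt := max_colnorm T in dT *.
pose E := delta_gradient f x S T - S^T *m hessian f x.
have E_le : spnorm E <= Num.sqrt m%:R *
    (spnorm (pinv T) * (Num.sqrt k%:R * (L * ds * dt * ((ds + dt) / 2)))).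
  apply: spnorm_rows_le => [|i].
    by rewrite !mulr_ge0 ?spnorm_ge0 ?sqrtr_ge0 ?addr_ge0 ?invr_ge0 ?max_colnorm_ge0.
  have -> : (row i E)^T = simplex_gradient f (x + col i S) T
      - simplex_gradient f x T - (hessian f x)^T *m col i S.
    rewrite linearB/= [LHS]linearB/= rowK trmxK row_mul -tr_col.
    by rewrite trmx_mul trmxK.
  apply: (simplex_gradient_difference_error f_C2 L_lip) => //.
  exact: max_colnorm_ge.
rewrite (le_trans (spnormM_le _ _))//.
have normS : spnorm (pinv S^T) <= ds^-1 * spnorm (pinv (normalized S)^T).
  rewrite !pinv_tr pinv_normalized// linearZ/= -/ds.
  rewrite -[in leLHS](scalerK (lt0r_neq0 dS) (pinv S)^T).
  by rewrite (le_trans (spnormZ_le _ _))// gtr0_norm ?invr_gt0.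
have normT : spnorm (pinv T) <= dt^-1 * spnorm (pinv (normalized T)).
  rewrite pinv_normalized// -/dt -[in leLHS](scalerK (lt0r_neq0 dT) (pinv T)).
  by rewrite (le_trans (spnormZ_le _ _))// gtr0_norm ?invr_gt0.
set a := spnorm (pinv (normalized S)^T) in normS *.
set b := spnorm (pinv (normalized T)) in normT *.
have a0 : 0 <= a by exact: spnorm_ge0.
have b0 : 0 <= b by exact: spnorm_ge0.
set M := L * ds * dt * ((ds + dt) / 2) in E_le.
have M0 : 0 <= M by rewrite !mulr_ge0 ?addr_ge0 ?invr_ge0 ?max_colnorm_ge0.
apply: (@le_trans _ _
    ((ds^-1 * a) * (Num.sqrt m%:R * ((dt^-1 * b) * (Num.sqrt k%:R * M))))).
  apply: ler_pM; rewrite ?spnorm_ge0// (le_trans E_le)//.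
  by rewrite ler_wpM2l ?sqrtr_ge0// ler_wpM2r// mulr_ge0 ?sqrtr_ge0.
rewrite [leLHS](_ : _ = Num.sqrt m%:R * Num.sqrt k%:R * L * a * b *
    ((ds + dt) / 2)).
  rewrite ler_wpM2l ?mulr_ge0 ?sqrtr_ge0//.
  rewrite ler_pdivrMr// mulrDr mulr1 lerD// le_max lexx ?orbT//.
by rewrite /M; field; rewrite !gt_eqF.
Qed.

Lemma sqrt_nat_le (R : realType) (m : nat) : Num.sqrt m%:R <= m%:R :> R.
Proof.
case: m => [|m]; first by rewrite sqrtr0.
rewrite -ler_sqr ?nnegrE ?sqrtr_ge0// sqr_sqrtr// -natrX ler_nat.
by rewrite leq_pmulr.
Qed.

Theorem proposition4p1 (R : realType) (n m k : nat)
    (domf : set 'cV[R]_n) (f : 'cV[R]_n -> R) (x0 : 'cV[R]_n) (Dbar L : R)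
    (S : 'M[R]_(n, m)) (T : 'M[R]_(n, k))
    (x0_dom : domf x0) (Dbar_gt0 : 0 < Dbar)
    (ball_dom : eball x0 Dbar `<=` domf)
    (f_C3 : Ck_on 3 (eball x0 Dbar) f)
    (L_lip : lipschitz_constant (eball x0 Dbar) (hessian f) L)
    (S_full : row_free S) (T_full : row_free T)
    (samples_dom : sample_points x0 S T `<=` domf)
    (* the balls are open, so the next inclusion alone would allow
       x0 + s^i + t^j to lie on the boundary, where f is arbitrary *)
    (samples_ball : sample_points x0 S T `<=` eball x0 Dbar)
    (balls_sub : forall i : 'I_m,
       eball (x0 + col i S) (max_colnorm T) `<=` eball x0 Dbar) :
  let Delta_u := Num.max (max_colnorm S) (max_colnorm T) in
  let Delta_l := Num.min (max_colnorm S) (max_colnorm T) in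
  let Shat := normalized S in
  let That := normalized T in
  spnorm (nested_hessian f x0 S T - hessian f x0) <=
    (m%:R * Num.sqrt k%:R / 3) * L * (2 * (Delta_u / Delta_l) + 3) *
    spnorm (pinv Shat^T) * spnorm (pinv That) * Delta_u
  /\
  (Delta_u = Delta_l ->
   spnorm (nested_hessian f x0 S T - hessian f x0) <=
     (5 * m%:R * Num.sqrt k%:R / 3) * L *
     spnorm (pinv Shat^T) * spnorm (pinv That) * Delta_u).
Proof.
move=> Du Dl Sh Th.
(* In dimension 0 both radii vanish and the quotient [Du / Dl] is void, but
   all the matrices involved are empty. *)
have [n0|n_gt0] := posnP n.
  have spnorm_dim0 p (A : 'M[R]_(n, p)) : spnorm A = 0.
    suff -> : A = 0 by exact: spnorm0.
    apply/matrixP => i; exfalso.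
    by have := ltn_ord i; rewrite [in X in (_ < X)%N]n0.
  by rewrite !spnorm_dim0 !(mulr0, mul0r).
have dS := max_colnorm_gt0 n_gt0 S_full; have dT := max_colnorm_gt0 n_gt0 T_full.
have L_ge0 := lipschitz_constant_ge0 n_gt0 Dbar_gt0 L_lip.
have main : spnorm (nested_hessian f x0 S T - hessian f x0) <=
    Num.sqrt m%:R * Num.sqrt k%:R * L *
    spnorm (pinv Sh^T) * spnorm (pinv Th) * Du.
  apply: nested_hessian_error L_lip _ _ _ _ _ samples_ball => //.
  exact: Ck_onS.
set a := spnorm (pinv Sh^T) in main *; set b := spnorm (pinv Th) in main *.
have Du_gt0 : 0 < Du by rewrite lt_max dS.
have Dl_gt0 : 0 < Dl by rewrite lt_min dS.
have weaken c : 1 <= c -> spnorm (nested_hessian f x0 S T - hessian f x0) <=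
    c * (m%:R * Num.sqrt k%:R * L * a * b * Du).
  move=> c_ge1; have rest_ge0 : 0 <= Num.sqrt k%:R * L * a * b * Du.
    by rewrite !mulr_ge0 ?sqrtr_ge0 ?spnorm_ge0// ltW.
  apply: (le_trans main).
  rewrite [leLHS](_ : _ = Num.sqrt m%:R * (Num.sqrt k%:R * L * a * b * Du));
    last by ring.
  rewrite [leRHS](_ : _ = c * m%:R * (Num.sqrt k%:R * L * a * b * Du));
    last by ring.
  by rewrite ler_wpM2r// (le_trans (sqrt_nat_le R m))// ler_peMl.
have ratio_ge1 : 1 <= Du / Dl.
  by rewrite ler_pdivlMr// mul1r ge_min !le_max !lexx.
split=> [|_].
  rewrite [leRHS](_ : _ = ((2 * (Du / Dl) + 3) / 3) *
     (m%:R * Num.sqrt k%:R * L * a * b * Du)).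
    by apply: weaken; lra.
  by field; rewrite gt_eqF.
rewrite [leRHS](_ : _ = (5 / 3) * (m%:R * Num.sqrt k%:R * L * a * b * Du)).
  by apply: weaken; lra.
by field.
Qed.
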